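(* Let $A_1A_2A_3A_4A_5$ be a closed hexahedron in $\mathbb{R}^3$ (a polyhedron with the five vertices $A_1,\ldots,A_5$), let $A_0$ be a point in its interior, and let $c>0$. Let $(\bar B_i)_{12345}$, $i=1,\ldots,5$, be non-negative weights, with $(\bar B_4)_{12345}>0$, such that $A_0$ minimizes $X\mapsto\sum_{i=1}^5(\bar B_i)_{12345}|XA_i|$ over $X\in\mathbb{R}^3$, and, writing $\bar B_i$ for $(\bar B_i)_{12345}$, $$\bar B_1+\bar B_2+\bar B_3+\bar B_4+\bar B_5=c,\qquad \bar B_1+\bar B_2+\bar B_3+\bar B_5=\bar B_0+\bar B_4,$$ where $\bar B_0$ is the residual weight at $A_0$. Assume that all the quantities in denominators below are non-zero. Then $$\Big(\frac{\bar B_1}{\bar B_4}\Big)_{12345}=-\frac{\mathrm{sgn}_{4,203}}{\mathrm{sgn}_{1,203}}\Big(\frac{\bar B_1}{\bar B_4}\Big)_{1234}\left(1+\frac{\mathrm{sgn}_{5,203}}{\mathrm{sgn}_{4,203}}\Big(\frac{\bar B_5}{\bar B_4}\Big)_{12345}\Big(\frac{\bar B_4}{\bar B_5}\Big)_{2345}\right),$$ $$\Big(\frac{\bar B_2}{\bar B_4}\Big)_{12345}=-\frac{\mathrm{sgn}_{4,103}}{\mathrm{sgn}_{2,103}}\Big(\frac{\bar B_2}{\bar B_4}\Big)_{1234}\left(1+\frac{\mathrm{sgn}_{5,103}}{\mathrm{sgn}_{4,103}}\Big(\frac{\bar B_5}{\bar B_4}\Big)_{12345}\Big(\frac{\bar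 B_4}{\bar B_5}\Big)_{1345}\right),$$ $$\Big(\frac{\bar B_3}{\bar B_4}\Big)_{12345}=-\frac{\mathrm{sgn}_{4,102}}{\mathrm{sgn}_{3,102}}\Big(\frac{\bar B_3}{\bar B_4}\Big)_{1234}\left(1+\frac{\mathrm{sgn}_{5,102}}{\mathrm{sgn}_{4,102}}\Big(\frac{\bar B_5}{\bar B_4}\Big)_{12345}\Big(\frac{\bar B_4}{\bar B_5}\Big)_{1245}\right).$$
   Context: For distinct $i,j,k$, $\alpha_{i,j0k}$ denotes the angle between the ray $A_0A_i$ and the plane $A_jA_0A_k$ (the angle between $A_0A_i$ and the segment from $A_0$ to the foot of the orthogonal projection of $A_i$ onto that plane). Fix a normal vector $N_{j0k}$ to each plane $A_jA_0A_k$. Then $\mathrm{sgn}_{i,j0k}=+1$ if $A_i$ lies on the side of the plane $A_jA_0A_k$ to which $N_{j0k}$ points, $0$ if $A_i$ lies in that plane, and $-1$ if $A_i$ lies on the opposite side. $(\bar B_i)_{12345}$ is the weight attached to the vertex on the ray $A_0A_i$, and $(\bar B_i/\bar B_j)_{12345}=(\bar B_i)_{12345}/(\bar B_j)_{12345}$. For four distinct indices forming a set $\{i,j,k,l\}$, the ratio $(\bar B_i/\bar B_j)_{ijkl}$ (the order of the subscripts being irrelevant) is the weight ratio for the tetrahedron $A_iA_jA_kA_l$ given by the solution of the inverse mixed weighted Fermat-Torricelli problem for tetrahedra, namely $$\Big(\frac{\bar B_i}{\bar B_j}\Big)_{ijkl}=\frac{\sin\alpha_{j,k0l}}{\sin\alpha_{i,k0l}}.$$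 The residual weight $\bar B_0$ is a positive number remaining at $A_0$. *)

(* Defs.v *)
From HB Require Import structures.
From mathcomp Require Import all_boot all_order all_algebra.
From mathcomp Require Import all_classical all_reals all_analysis.

Set Implicit Arguments.
Unset Strict Implicit.
Unset Printing Implicit Defensive.

Import Order.TTheory GRing.Theory Num.Theory.
Import numFieldNormedType.Exports.

Local Open Scope classical_set_scope.
Local Open Scope ring_scope.

(* The library norm on 'rV[R]_3 is the sup norm (same topology), hence the
   Euclidean one below. *)
Definition dot (R : realType) (u v : 'rV[R]_3) : R := \sum_(i < 3) u 0 i * v 0 i.

Definition enorm (R : realType) (u : 'rV[R]_3) : R := Num.sqrt (dot u u).

Definition dist (R : realType) (X Y : 'rV[R]_3) : R := enorm (Y - X).

(* When u or v is 0, the quotient is 0 and the angle is pi / 2. *)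
Definition angle (R : realType) (u v : 'rV[R]_3) : R :=
  acos (dot u v / (enorm u * enorm v)).

Definition noncollinear (R : realType) (P Q S : 'rV[R]_3) : Prop :=
  row_free (col_mx (Q - P) (S - P)).

Definition plane (R : realType) (P Q S : 'rV[R]_3) : set 'rV[R]_3 :=
  [set X | exists s t : R, X = P + s *: (Q - P) + t *: (S - P)].

Definition foot (R : realType) (P Q S X : 'rV[R]_3) : 'rV[R]_3 :=
  get [set Y | plane P Q S Y /\
               forall Z, plane P Q S Z -> dot (X - Y) (Z - Y) = 0].

(* [A0] is the point A_0 and [A : 'I_5 -> _] lists the vertices A_1, ..., A_5;
   [v1], ..., [v5] restore the numbering from 1. *)
Definition v1 : 'I_5 := @Ordinal 5 0 isT.
Definition v2 : 'I_5 := @Ordinal 5 1 isT.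
Definition v3 : 'I_5 := @Ordinal 5 2 isT.
Definition v4 : 'I_5 := @Ordinal 5 3 isT.
Definition v5 : 'I_5 := @Ordinal 5 4 isT.

Section Hexahedron.
Variables (R : realType) (A : 'I_5 -> 'rV[R]_3).

Definition hull (F : {set 'I_5}) : set 'rV[R]_3 :=
  [set X | exists w : 'I_5 -> R,
     [/\ forall i, 0 <= w i, \sum_(i in F) w i = 1
       & X = \sum_(i in F) w i *: A i]].

Definition affinely_independent (F : {set 'I_5}) : Prop :=
  forall w : 'I_5 -> R,
    \sum_(i in F) w i = 0 -> \sum_(i in F) w i *: A i = 0 ->
    forall i, i \in F -> w i = 0.

(* [P] is the solid bounded by six nondegenerate triangles with the five
   vertices [A i]: the triangles meet only along common edges or at common
   vertices, and each edge lies on exactly two of them.  With five vertices and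
   six faces, every face is a triangle.  [P] need not be convex, and adjacent
   faces may be coplanar. *)
Definition closed_hexahedron (P : set 'rV[R]_3) : Prop :=
  exists T : {set {set 'I_5}},
    [/\ [/\ #|T| = 6%N,
            forall F, F \in T -> #|F| = 3%N,
            finset.cover T = [set: 'I_5]%SET
          & forall e : {set 'I_5}, #|e| = 2%N ->
              forall F, F \in T -> e \subset F ->
              #|[set G in T | e \subset G]%SET| = 2%N],
        forall F, F \in T -> affinely_independent F,
        forall F G, F \in T -> G \in T ->
          hull F `&` hull G = hull (F :&: G)%SET
      & [/\ compact P, closure P° = P
          & closure P `\` P° = [set X | exists2 F, F \in T & hull F X]]].

End Hexahedron.

Section Angles.
Variables (R : realType) (A0 : 'rV[R]_3) (A : 'I_5 -> 'rV[R]_3).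

(* alpha_{i,j0k}; if A_0A_i is orthogonal to the plane, the foot is A_0 and the
   angle is pi / 2. *)
Definition alpha (i j k : 'I_5) : R :=
  angle (A i - A0) (foot A0 (A j) (A k) (A i) - A0).

Definition normal_to_plane (n : 'rV[R]_3) (j k : 'I_5) : Prop :=
  [/\ n != 0, dot n (A j - A0) = 0 & dot n (A k - A0) = 0].

(* sgn_{i,j0k}, where [N j k] is the chosen normal vector of A_jA_0A_k. *)
Definition side_sgn (N : 'I_5 -> 'I_5 -> 'rV[R]_3) (i j k : 'I_5) : R :=
  Num.sg (dot (N j k) (A i - A0)).

(* (B_i / B_j)_{ijkl} *)
Definition tetra_ratio (i j k l : 'I_5) : R :=
  sin (alpha j k l) / sin (alpha i k l).

End Angles.

Definition minimizes_weighted_distance (R : realType) (B : 'I_5 -> R)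
    (A : 'I_5 -> 'rV[R]_3) (A0 : 'rV[R]_3) : Prop :=
  forall X : 'rV[R]_3,
    \sum_(i < 5) B i * dist A0 (A i) <= \sum_(i < 5) B i * dist X (A i).

(* Main.v *)
Require Import Defs.
From HB Require Import structures.
From mathcomp Require Import all_boot all_order all_algebra.
From mathcomp Require Import all_classical all_reals all_analysis.
From mathcomp Require Import ring lra.
Set Implicit Arguments.
Unset Strict Implicit.
Import Order.TTheory GRing.Theory Num.Theory.
Import numFieldNormedType.Exports.
Local Open Scope classical_set_scope.
Local Open Scope ring_scope.


(** The function X |-> sum_i B_i |X A_i| is differentiable away from the
    vertices, and an interior point of the polyhedron is not a vertex.  So at
    the minimum A_0 the gradient vanishes: the unit vectors u_i from A_0 to A_i
    satisfy sum_i B_i u_i = 0 ([weighted_unit_vectors_balance]).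

    Take the inner product of this balance with the normal N of a plane
    A_jA_0A_k.  The terms of index j and k vanish, and each remaining <u_i, N>
    is |N| times the sine of the signed angle from the plane to the ray A_0A_i,
    namely sgn_{i,j0k} sin alpha_{i,j0k} ([sg_mul_sin_alpha]).  What is left is a
    linear relation between three weights,
      sum_{i <> j, k} B_i sgn_{i,j0k} sin alpha_{i,j0k} = 0
    ([plane_balance]).  Dividing it by the coefficient of one of the weights and
    by B_4 gives each of the three formulas ([ratio_of_plane_balance]). *)

(** * The Euclidean inner product *)

Section EuclideanProduct.
Variable R : realType.
Implicit Types u v w : 'rV[R]_3.

Lemma dotC u v : dot u v = dot v u.
Proof. by apply: eq_bigr => i _; rewrite mulrC. Qed.

Lemma dotDl u v w : dot (u + v) w = dot u w + dot v w.
Proof.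
by rewrite /dot -big_split; apply: eq_bigr => i _; rewrite !mxE mulrDl.
Qed.

Lemma dotZl a u v : dot (a *: u) v = a * dot u v.
Proof.
by rewrite /dot mulr_sumr; apply: eq_bigr => i _; rewrite !mxE mulrA.
Qed.

Lemma dotDr u v w : dot u (v + w) = dot u v + dot u w.
Proof. by rewrite dotC dotDl !(dotC _ u). Qed.

Lemma dotZr a u v : dot u (a *: v) = a * dot u v.
Proof. by rewrite dotC dotZl dotC. Qed.

Lemma dotBl u v w : dot (u - v) w = dot u w - dot v w.
Proof. by rewrite -scaleN1r dotDl dotZl mulN1r. Qed.

Lemma dotBr u v w : dot u (v - w) = dot u v - dot u w.
Proof. by rewrite dotC dotBl !(dotC _ u). Qed.

Lemma dot_ge0 u : 0 <= dot u u.
Proof. by apply: sumr_ge0 => i _; rewrite -expr2 sqr_ge0. Qed.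

Lemma dot_eq0 u : (dot u u == 0) = (u == 0).
Proof.
apply/eqP/eqP => [uu0|->]; last first.
  by apply: big1 => i _; rewrite mxE mul0r.
apply/rowP => i; rewrite mxE; apply/eqP; rewrite -sqrf_eq0 expr2.
move/eqP: uu0; rewrite psumr_eq0; last by move=> k _; rewrite -expr2 sqr_ge0.
by move=> /allP /(_ i (mem_index_enum i)).
Qed.

Lemma enorm_ge0 u : 0 <= enorm u.
Proof. exact: sqrtr_ge0. Qed.

Lemma sqr_enorm u : enorm u ^+ 2 = dot u u.
Proof. by rewrite sqr_sqrtr ?dot_ge0. Qed.

Lemma enorm_eq0 u : (enorm u == 0) = (u == 0).
Proof. by rewrite -sqrf_eq0 sqr_enorm dot_eq0. Qed.

Lemma enorm_gt0 u : (0 < enorm u) = (u != 0).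
Proof. by rewrite lt_neqAle enorm_ge0 andbT eq_sym enorm_eq0. Qed.

(** This is the inequality of arithmetic and geometric means
    2 |w| |w - v| <= |w|^2 + |w - v|^2; its right-hand side is the first-order
    expansion of |w - v| with a quadratic remainder. *)
Lemma enorm_sub_le w v : w != 0 ->
  enorm (w - v) <= enorm w - dot w v / enorm w + dot v v / (2 * enorm w).
Proof.
move=> w0; have ew0 : 0 < enorm w by rewrite enorm_gt0.
have -> : enorm w - dot w v / enorm w + dot v v / (2 * enorm w) =
    (enorm w ^+ 2 + enorm (w - v) ^+ 2) / (2 * enorm w).
  rewrite (sqr_enorm (w - v)) dotBl !dotBr (dotC v w) -(sqr_enorm w).
  by field; rewrite gt_eqF.
rewrite ler_pdivlMr ?mulr_gt0 //.
have := sqr_ge0 (enorm w - enorm (w - v)); nra.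
Qed.

End EuclideanProduct.

(** * The balance of the weights at a minimum *)

(** A linear function bounded by a quadratic one that vanishes to second order
    at 0 is zero. *)
Lemma linear_le_quadratic_eq0 (R : realType) (s q : R) : 0 <= q ->
  (forall t, t * s <= t ^+ 2 * q) -> s = 0.
Proof.
move=> q0 le_sq.
(* t = s / (q + 1) turns the hypothesis into
   s^2 (q + 1) <= s^2 q after multiplication by (q + 1)^2. *)
have q1 : 0 < q + 1 by rewrite ltr_wpDl.
have := le_sq (s / (q + 1)).
have -> : s / (q + 1) * s = s ^+ 2 * (q + 1) / (q + 1) ^+ 2.
  by field; rewrite gt_eqF.
have -> : (s / (q + 1)) ^+ 2 * q = s ^+ 2 * q / (q + 1) ^+ 2.
  by field; rewrite gt_eqF.
rewrite ler_pM2r ?invr_gt0 ?exprn_gt0 // => sle.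
have s2 : s ^+ 2 <= 0 by nra.
by apply/eqP; rewrite -sqrf_eq0 eq_le s2 sqr_ge0.
Qed.

(** This is the vanishing of the gradient at the minimum.  Moving A_0 by t v
    changes the weighted sum by at most - t s + t^2 q, where s is the sum below:
    the bound [enorm_sub_le] holds for every t, so no derivative is involved. *)
Lemma weighted_unit_vectors_balance (R : realType) (B : 'I_5 -> R)
    (A : 'I_5 -> 'rV[R]_3) (A0 v : 'rV[R]_3) :
    (forall i, 0 <= B i) -> (forall i, A i - A0 != 0) ->
    minimizes_weighted_distance B A A0 ->
  \sum_(i < 5) B i * (dot (A i - A0) v / enorm (A i - A0)) = 0.
Proof.
move=> B0 A_neq Bmin.
pose w i := A i - A0.
apply: (@linear_le_quadratic_eq0 _ _
  (\sum_(i < 5) B i * (dot v v / (2 * enorm (w i))))).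
  apply: sumr_ge0 => i _; apply: mulr_ge0 => //.
  by rewrite divr_ge0 ?dot_ge0 // mulr_ge0 ?enorm_ge0.
move=> t; rewrite -subr_ge0.
have le1 i : B i * dist (A0 + t *: v) (A i) <= B i * dist A0 (A i)
    + (t ^+ 2 * (B i * (dot v v / (2 * enorm (w i))))
      - t * (B i * (dot (w i) v / enorm (w i)))).
  rewrite /dist opprD addrA -/(w i).
  have /le_trans-> // := ler_wpM2l (B0 i) (enorm_sub_le (t *: v) (A_neq i)).
  rewrite -/(w i) dotZl !dotZr le_eqVlt; apply/orP; left; apply/eqP.
  by field; rewrite enorm_eq0 A_neq.
have := le_trans (Bmin (A0 + t *: v)) (ler_sum _ (fun i _ => le1 i)).
by rewrite big_split /= lerDl sumrB -!mulr_sumr.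
Qed.

(** * The angle between a ray and a plane *)

Section RayPlaneAngle.
Variables (R : realType) (P Q S n : 'rV[R]_3).
Hypothesis PQS : noncollinear P Q S.
Hypotheses (n0 : n != 0) (nQ : dot n (Q - P) = 0) (nS : dot n (S - P) = 0).

(** In dimension 3 the orthogonal complement of n is 2-dimensional, so the two
    independent vectors Q - P and S - P span it. *)
Lemma plane_of_normal X : dot n (X - P) = 0 -> plane P Q S X.
Proof.
move=> nX.
have dotE (u : 'rV[R]_3) : (u <= kermx n^T)%MS = (dot n u == 0).
  apply/sub_kermxP/eqP => [un|un].
    have /matrixP/(_ 0 0) := un; rewrite !mxE dotC => un0.
    by rewrite -[RHS]un0; apply: eq_bigr => i _; rewrite mxE.
  apply/matrixP => i j; rewrite !ord1 !mxE -[RHS]un dotC.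
  by apply: eq_bigr => k _; rewrite mxE.
have sub : (col_mx (Q - P) (S - P) <= kermx n^T)%MS.
  by rewrite col_mx_sub !dotE nQ nS eqxx.
have rk : \rank (col_mx (Q - P) (S - P)) = \rank (kermx n^T).
  by rewrite (eqP PQS) mxrank_ker mxrank_tr rank_rV n0.
have : (X - P <= col_mx (Q - P) (S - P))%MS.
  apply: submx_trans (_ : kermx n^T <= _)%MS; first by rewrite dotE nX.
  by rewrite -(geq_leqif (mxrank_leqif_sup sub)) rk.
case/submxP => D XD; exists (D 0 (lshift 1 0)), (D 0 (rshift 1 0)).
have D2 : D = row_mx (D 0 (lshift 1 0))%:M (D 0 (rshift 1 0))%:M.
  rewrite -[LHS]hsubmxK; congr row_mx; apply/matrixP => i j;
  by rewrite !ord1 !mxE eqxx mulr1n.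
apply/eqP; rewrite -addrA addrC -subr_eq XD {1}D2 mul_row_col.
by rewrite !mul_scalar_mx.
Qed.

Lemma dot_normal_plane X : plane P Q S X -> dot n (X - P) = 0.
Proof.
move=> [s [t ->]].
by rewrite addrAC (addrC P) addrK dotDr !dotZr nQ nS !mulr0 addr0.
Qed.

(** The foot is chosen among the points Y of the plane with X - Y orthogonal to
    the plane; the point given by the formula is one of them, and there is only
    one. *)
Lemma footE X : foot P Q S X = X - (dot n (X - P) / dot n n) *: n.
Proof.
pose Y := X - (dot n (X - P) / dot n n) *: n.
have nn0 : dot n n != 0 by rewrite dot_eq0.
have Yplane : plane P Q S Y.
  apply: plane_of_normal; rewrite /Y addrAC [LHS]dotBr dotZr.
  by rewrite divfK // subrr.
have Yorth Z : plane P Q S Z -> dot (X - Y) (Z - Y) = 0.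
  move=> Zplane.
  have -> : X - Y = (dot n (X - P) / dot n n) *: n.
    by rewrite /Y opprB addrC subrK.
  have -> : Z - Y = (Z - P) - (Y - P) by rewrite (opprB Y) addrA subrK.
  by rewrite dotZl [dot n (_ - _ - _)]dotBr (dot_normal_plane Zplane)
    (dot_normal_plane Yplane) subrr mulr0.
have [] : [set Y | plane P Q S Y /\
    forall Z, plane P Q S Z -> dot (X - Y) (Z - Y) = 0] (foot P Q S X).
  by apply: (@getPex _ [set Y | plane P Q S Y /\
    forall Z, plane P Q S Z -> dot (X - Y) (Z - Y) = 0]); exists Y; split.
rewrite -/Y; move: (foot P Q S X) => F Fplane Forth.
(* F and Y both have the projection property: each of X - Y, X - F is
   orthogonal to F - Y, hence so is their difference F - Y. *)
apply/eqP; rewrite -subr_eq0 -dot_eq0; apply/eqP.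
have := Yorth _ Fplane; have := Forth _ Yplane; clearbody Y.
by rewrite !(dotBl, dotBr) => *; lra.
Qed.

(** The right triangle P, F, X, where F is the foot of X, has the leg
    XF = |<n, X - P>| / |n| opposite to the angle at P. *)
Lemma sin_angle_foot X : X - P != 0 ->
  sin (angle (X - P) (foot P Q S X - P)) =
  `|dot n (X - P)| / (enorm n * enorm (X - P)).
Proof.
move=> w0; rewrite footE addrAC; set w := X - P.
set c := dot n w / dot n n; set p := w - c *: n.
have nn0 : dot n n != 0 by rewrite dot_eq0.
have ew0 : enorm w != 0 by rewrite enorm_eq0.
have en0 : enorm n != 0 by rewrite enorm_eq0.
have np : dot n p = 0 by rewrite dotBr dotZr divfK ?subrr.
have wE : w = p + c *: n by rewrite subrK.
clearbody p.
have wp : dot w p = enorm p ^+ 2.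
  by rewrite {1}wE dotDl dotZl np mulr0 addr0 sqr_enorm.
have ww : enorm w ^+ 2 = enorm p ^+ 2 + (c * enorm n) ^+ 2.
  rewrite exprMn !sqr_enorm {1 2}wE dotDl !dotDr !dotZl !dotZr np (dotC p n) np.
  by ring.
(* If p = 0, the ray is orthogonal to the plane; the angle is then acos 0, and
   the cosine |p| / |w| is 0 as well. *)
have cosE : dot w p / (enorm w * enorm p) = enorm p / enorm w.
  have [->|ep0] := eqVneq (enorm p) 0; first by rewrite mulr0 invr0 mulr0 mul0r.
  by rewrite wp; field; rewrite ep0 ew0.
have le_pw : enorm p / enorm w <= 1.
  rewrite ler_pdivrMr ?enorm_gt0 // mul1r -(ler_pXn2r (n := 2)) ?nnegrE ?enorm_ge0 //.
  by rewrite ww lerDl sqr_ge0.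
have ge_pw : 0 <= enorm p / enorm w by rewrite divr_ge0 ?enorm_ge0.
rewrite /angle cosE sin_acos; last by rewrite le_pw andbT (le_trans _ ge_pw) // oppr_le0.
have -> : 1 - (enorm p / enorm w) ^+ 2 = (c * enorm n / enorm w) ^+ 2.
  have -> : (c * enorm n / enorm w) ^+ 2 =
      (enorm w ^+ 2 - enorm p ^+ 2) / enorm w ^+ 2.
    by rewrite {1}ww; field.
  by field.
rewrite sqrtr_sqr.
have -> : c * enorm n / enorm w = dot n w / (enorm n * enorm w).
  by rewrite /c -(sqr_enorm n); field; rewrite ew0 en0.
by rewrite normrM normfV (ger0_norm (mulr_ge0 _ _)) ?enorm_ge0.
Qed.

End RayPlaneAngle.

(** The angle alpha is unsigned, hence the absolute value in [sin_angle_foot];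
    the side of A_i restores the sign and makes the expression linear in the
    unit vector of A_0A_i. *)
Lemma sg_mul_sin_alpha (R : realType) (A0 : 'rV[R]_3) (A : 'I_5 -> 'rV[R]_3)
    (N : 'I_5 -> 'I_5 -> 'rV[R]_3) (i j k : 'I_5) :
    noncollinear A0 (A j) (A k) -> normal_to_plane A0 A (N j k) j k ->
    A i - A0 != 0 ->
  side_sgn A0 A N i j k * sin (alpha A0 A i j k) =
  dot (A i - A0) (N j k) / enorm (A i - A0) / enorm (N j k).
Proof.
move=> ncol [N0 Nj Nk] Ai; rewrite /alpha (sin_angle_foot ncol N0) //.
by rewrite mulrA -numEsg [in RHS]dotC -mulrA -invfM (mulrC (enorm (A i - A0))).
Qed.

(** * Relations between the weights *)

(** Every vertex belongs to a face, and the faces make up the boundary. *)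
Lemma interior_not_vertex (R : realType) (A : 'I_5 -> 'rV[R]_3)
    (P : set 'rV[R]_3) (A0 : 'rV[R]_3) (i : 'I_5) :
  closed_hexahedron A P -> P° A0 -> A i - A0 != 0.
Proof.
move=> [T [[_ _ covT _] _ _ [_ _ bdP]]] A0P; rewrite subr_eq0.
suff Ai_bd : ~ P° (A i) by apply/eqP => AiA0; apply: Ai_bd; rewrite AiA0.
have : i \in finset.cover T by rewrite covT finset.in_setT.
case/bigcupP => F FT iF.
suff : (closure P `\` P°) (A i) by case.
rewrite bdP; exists F => //; exists (fun k => (k == i)%:R); split.
- by move=> k; rewrite ler0n.
- rewrite (bigD1 i) //= eqxx big1 ?addr0 // => k /andP[_ /negbTE ->] //.
- rewrite (bigD1 i) //= eqxx scale1r big1 ?addr0 // => k /andP[_ /negbTE ->].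
  by rewrite scale0r.
Qed.

(** The inner product of the balance with the normal of the plane A_jA_0A_k
    eliminates the weights of A_j and A_k. *)
Lemma plane_balance (R : realType) (A : 'I_5 -> 'rV[R]_3) (A0 : 'rV[R]_3)
    (B : 'I_5 -> R) (N : 'I_5 -> 'I_5 -> 'rV[R]_3) (j k i l m : 'I_5) :
    (forall i, 0 <= B i) -> (forall i, A i - A0 != 0) ->
    minimizes_weighted_distance B A A0 ->
    noncollinear A0 (A j) (A k) -> normal_to_plane A0 A (N j k) j k ->
    uniq [:: j; k; i; l; m] ->
  B i * (side_sgn A0 A N i j k * sin (alpha A0 A i j k)) +
  B l * (side_sgn A0 A N l j k * sin (alpha A0 A l j k)) +
  B m * (side_sgn A0 A N m j k * sin (alpha A0 A m j k)) = 0.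
Proof.
move=> B0 A_neq Bmin ncol Njk uniq5; have [_ Nj Nk] := Njk.
have perm5 : perm_eq (index_enum 'I_5) [:: j; k; i; l; m].
  rewrite perm_sym; apply: uniq_perm; rewrite ?index_enum_uniq //.
  have sub : {subset [:: j; k; i; l; m] <= index_enum 'I_5}.
    by move=> x _; exact: mem_index_enum.
  have [|_ eq5] // := uniq_min_size uniq5 sub.
  by rewrite [index_enum _]unlock -enumT size_enum_ord.
have := weighted_unit_vectors_balance (N j k) B0 A_neq Bmin.
rewrite (perm_big _ perm5) !big_cons big_nil /=.
rewrite (dotC (A j - A0)) Nj (dotC (A k - A0)) Nk !mul0r !mulr0 !add0r addr0 => bal.
rewrite !sg_mul_sin_alpha // !mulrA -!mulrDl -!mulrA.
by rewrite -addrA bal mul0r.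
Qed.

Lemma ratio_of_plane_balance (F : fieldType) (b1 b4 b5 s1 s4 s5 a1 a4 a5 : F) :
    b4 != 0 -> s1 != 0 -> s4 != 0 -> a1 != 0 -> a4 != 0 ->
    b1 * (s1 * a1) + b4 * (s4 * a4) + b5 * (s5 * a5) = 0 ->
  b1 / b4 = - (s4 / s1) * (a4 / a1) * (1 + s5 / s4 * (b5 / b4) * (a5 / a4)).
Proof.
move=> b40 s10 s40 a10 a40 bal.
have -> : b1 = - (b4 * (s4 * a4) + b5 * (s5 * a5)) / (s1 * a1).
  apply: (canRL (mulfK _)); first by rewrite mulf_neq0.
  by apply/eqP; rewrite -addr_eq0 addrA bal.
by field; rewrite b40 s10 s40 a10 a40.
Qed.

Theorem proposition4 (R : realType) (A : 'I_5 -> 'rV[R]_3)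
    (P : set 'rV[R]_3) (hP : closed_hexahedron A P)
    (A0 : 'rV[R]_3) (hA0 : P° A0)
    (c : R) (hc : 0 < c)
    (B : 'I_5 -> R) (hB : forall i, 0 <= B i) (hB4 : 0 < B v4)
    (hmin : minimizes_weighted_distance B A A0)
    (hsum : B v1 + B v2 + B v3 + B v4 + B v5 = c)
    (B0 : R) (hB0 : 0 < B0)
    (hres : B v1 + B v2 + B v3 + B v5 = B0 + B v4)
    (* the planes A_2A_0A_3, A_1A_0A_3 and A_1A_0A_2 are well defined *)
    (h203 : noncollinear A0 (A v2) (A v3))
    (h103 : noncollinear A0 (A v1) (A v3))
    (h102 : noncollinear A0 (A v1) (A v2))
    (N : 'I_5 -> 'I_5 -> 'rV[R]_3)
    (hN : forall j k, j != k -> noncollinear A0 (A j) (A k) ->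
            normal_to_plane A0 A (N j k) j k)
    (* the denominators are non-zero *)
    (hs1 : side_sgn A0 A N v1 v2 v3 != 0)
    (hs4_203 : side_sgn A0 A N v4 v2 v3 != 0)
    (hs2 : side_sgn A0 A N v2 v1 v3 != 0)
    (hs4_103 : side_sgn A0 A N v4 v1 v3 != 0)
    (hs3 : side_sgn A0 A N v3 v1 v2 != 0)
    (hs4_102 : side_sgn A0 A N v4 v1 v2 != 0)
    (ha1 : sin (alpha A0 A v1 v2 v3) != 0)
    (ha4_203 : sin (alpha A0 A v4 v2 v3) != 0)
    (ha2 : sin (alpha A0 A v2 v1 v3) != 0)
    (ha4_103 : sin (alpha A0 A v4 v1 v3) != 0)
    (ha3 : sin (alpha A0 A v3 v1 v2) != 0)
    (ha4_102 : sin (alpha A0 A v4 v1 v2) != 0) :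
  [/\ B v1 / B v4 =
        - (side_sgn A0 A N v4 v2 v3 / side_sgn A0 A N v1 v2 v3)
        * tetra_ratio A0 A v1 v4 v2 v3
        * (1 + side_sgn A0 A N v5 v2 v3 / side_sgn A0 A N v4 v2 v3
               * (B v5 / B v4) * tetra_ratio A0 A v4 v5 v2 v3),
      B v2 / B v4 =
        - (side_sgn A0 A N v4 v1 v3 / side_sgn A0 A N v2 v1 v3)
        * tetra_ratio A0 A v2 v4 v1 v3
        * (1 + side_sgn A0 A N v5 v1 v3 / side_sgn A0 A N v4 v1 v3
               * (B v5 / B v4) * tetra_ratio A0 A v4 v5 v1 v3)
    & B v3 / B v4 =
        - (side_sgn A0 A N v4 v1 v2 / side_sgn A0 A N v3 v1 v2)
        * tetra_ratio A0 A v3 v4 v1 v2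
        * (1 + side_sgn A0 A N v5 v1 v2 / side_sgn A0 A N v4 v1 v2
               * (B v5 / B v4) * tetra_ratio A0 A v4 v5 v1 v2)].
Proof.
have A_neq i : A i - A0 != 0 by exact: interior_not_vertex hP hA0.
have b4 : B v4 != 0 by rewrite gt_eqF.
have bal j k i l m (jk : j != k) (ncol : noncollinear A0 (A j) (A k)) :=
  @plane_balance R A A0 B N j k i l m hB A_neq hmin ncol (hN j k jk ncol).
rewrite /tetra_ratio; split.
- exact: ratio_of_plane_balance b4 hs1 hs4_203 ha1 ha4_203
    (@bal v2 v3 v1 v4 v5 isT h203 isT).
- exact: ratio_of_plane_balance b4 hs2 hs4_103 ha2 ha4_103
    (@bal v1 v3 v2 v4 v5 isT h103 isT).
- exact: ratio_of_plane_balance b4 hs3 hs4_102 ha3 ha4_102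
    (@bal v1 v2 v3 v4 v5 isT h102 isT).
Qed.
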